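(* The relation $=$ on games is an equivalence relation compatible with addition and negation of games, and the equivalence classes formed by equal games form an additive abelian GROUP (an abelian group whose underlying collection may be a proper class) under the operations induced by the sum $G+H$ and the negative $-G$ of games; its zero element is represented by any game $G$ with $G=0$.
   Context: A game is an ordered pair $G=(L,R)$ of sets of games, where $L$ is the set of left options and $R$ the set of right options, subject to the Descending Game Condition: there is no infinite sequence of games $G^0,G^1,G^2,\dots$ in which every $G^{i+1}$ is a left or right option of $G^i$. The sets $L,R$ may be empty or infinite. One writes $G=\{G^L,\dots\mid G^R,\dots\}$, where $G^L$ and $G^R$ denote arbitrary left and right options of $G$. Order, defined recursively: $G\ge 0$ iff there is no right option $G^R$ with $G^R\le 0$; $G\le 0$ iff there is no left option $G^L$ with $G^L\ge 0$. Then $G=0$ means $G\ge 0$ and $G\le 0$. Arithmetic, defined recursively: $G+H$ is the game with left options all $G^L+H$ and all $G+H^L$, and right options all $G^R+H$ and all $G+H^R$; $-G$ is the game with left options all $-G^R$ and right options all $-G^L$; $G-H$ is $G+(-H)$. For two games, $G=H$ means $G-H=0$ (this is a defined relation, not set-theoretic identity of games). *)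

(* Defs.v *)
From HB Require Import structures.
From Corelib Require Export RelationClasses Morphisms.
From mathcomp Require Export all_boot ssralg.
From mathcomp Require Export boolp classical_sets.

Set Implicit Arguments.
Unset Strict Implicit.
Unset Printing Implicit Defensive.

Local Open Scope classical_set_scope.

(* The two sets of options are given as families indexed by arbitrary (possibly
   empty or infinite) types; [game] lives in a larger universe than the index
   types, so the games form a proper class relative to them. The identity of
   games plays no role, hence neither do repetitions in a family. *)
Inductive game : Type :=
  Game (LI RI : Type) (GL : LI -> game) (GR : RI -> game).

Definition is_left_option (H G : game) : Prop :=
  let: Game LI _ GL _ := G in exists i : LI, GL i = H.

Definition is_right_option (H G : game) : Prop :=
  let: Game _ RI _ GR := G in exists j : RI, GR j = H.

(* Well-foundedness of [game] yields the Descending Game Condition. *)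
Lemma descending_game_condition :
  ~ exists G : nat -> game,
      forall n, is_left_option (G n.+1) (G n) \/ is_right_option (G n.+1) (G n).
Proof.
move=> [G GP].
have noG H : forall n, G n <> H.
  elim: H => LI RI GL IHL GR IHR n Gn.
  by have := GP n; rewrite Gn => -[[k]|[k]] /esym; [apply: IHL|apply: IHR].
exact: (noG (G 0) 0).
Qed.

Fixpoint ge0 (G : game) : Prop :=
  let: Game _ RI _ GR := G in ~ exists j : RI, le0 (GR j)
with le0 (G : game) : Prop :=
  let: Game LI _ GL _ := G in ~ exists i : LI, ge0 (GL i).

Definition eq0 (G : game) : Prop := ge0 G /\ le0 G.

Fixpoint addg (G : game) : game -> game :=
  fix addG (H : game) : game :=
    let: Game GLI GRI GL GR := G in
    let: Game HLI HRI HL HR := H in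
    Game (fun k : GLI + HLI => match k with
                               | inl i => addg (GL i) H
                               | inr i => addG (HL i)
                               end)
         (fun k : GRI + HRI => match k with
                               | inl j => addg (GR j) H
                               | inr j => addG (HR j)
                               end).

Fixpoint oppg (G : game) : game :=
  let: Game LI RI GL GR := G in
  Game (fun j : RI => oppg (GR j)) (fun i : LI => oppg (GL i)).

Definition subg (G H : game) : game := addg G (oppg H).

Definition eqg (G H : game) : Prop := eq0 (subg G H).

Definition game_class : Type :=
  {C : set game | exists G, C = [set H | eqg G H]}.

Definition class_of (G : game) : game_class :=
  exist _ [set H | eqg G H] (ex_intro _ G erefl).

(* MathComp's [zmodType] requires a choice structure on its carrier. *)
HB.instance Definition _ := gen_eqMixin game_class.
HB.instance Definition _ := gen_choiceMixin game_class.

Definition game_zmod (M : GRing.isZmodule game_class) : zmodType :=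
  HB.pack_for zmodType game_class M.

(* Main.v *)
Require Import Defs.
From mathcomp Require Import all_boot ssralg.

(** Read [ge0 G] as: Left has a winning reply to every move when Right starts,
    and [le0 G] symmetrically. The theorem then rests on three strategy
    arguments:
    - answering in the component where the opponent has just moved wins a sum
      of games that are won separately, so [ge0] is closed under [addg]
      ([ge0_add]);
    - copying the opponent's moves in the other component wins [subg G G]
      ([ge0_subgg]);
    - a component that is zero can be removed from a sum that is zero
      ([eq0_cancelr]): if Right had a winning move in [G], the same move would
      win in [addg G H] as soon as [le0 H].

    Everything else is rearrangement of sums. For instance, if
    [subg G H] and [subg H K] are zero, then so is their sum, which regroups as
    [addg (subg G K) (subg H H)], and cancelling [subg H H] yields transitivity.
    The commutativity and associativity needed for such regroupings cannot be
    expected of Leibniz equality, since they change the index types of the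
    options (a sum of types is not literally commutative). They hold for
    [ident], the set-theoretic identity of games (equal sets of options,
    hereditarily), which is a congruence and preserves [ge0] and [le0]; so the
    rearrangements are done by rewriting with [ident]. In contrast, the laws of [oppg] preserve the
    index types and hold as equalities, by functional extensionality. *)

Set Implicit Arguments.
Unset Strict Implicit.
Unset Printing Implicit Defensive.

Local Open Scope ring_scope.

(** * Set-theoretic identity of games *)

(** Two indexed families have the same image, up to a relation between their
    terms, iff the induced relation on indices is total on both sides. *)
Definition bitotal (I J : Type) (R : I -> J -> Prop) : Prop :=
  (forall i, exists j, R i j) /\ (forall j, exists i, R i j).

Lemma bitotal_maps (I J : Type) (R : I -> J -> Prop) (f : I -> J) (g : J -> I) :
  (forall i, R i (f i)) -> (forall j, R (g j) j) -> bitotal R.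
Proof. by move=> Rf Rg; split=> k; [exists (f k)|exists (g k)]. Qed.

Fixpoint ident (G H : game) : Prop :=
  let: Game GLI GRI GL GR := G in
  let: Game HLI HRI HL HR := H in
  bitotal (fun i k => ident (GL i) (HL k)) /\
  bitotal (fun i k => ident (GR i) (HR k)).

Lemma ident_refl : Reflexive ident.
Proof. by elim=> LI RI GL IHL GR IHR; split; apply: (@bitotal_maps _ _ _ id id). Qed.
#[local] Hint Resolve ident_refl : core.

Lemma ident_sym : Symmetric ident.
Proof.
elim=> GLI GRI GL IHL GR IHR [HLI HRI HL HR] [[L1 L2] [R1 R2]].
by split; split=> k /=;
  [have [i] := L2 k|have [i] := L1 k|have [i] := R2 k|have [i] := R1 k];
  exists i; auto.
Qed.

Lemma ident_trans : Transitive ident.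
Proof.
elim=> GLI GRI GL IHL GR IHR [HLI HRI HL HR] [KLI KRI KL KR].
move=> [[L1 L2] [R1 R2]] [[L1' L2'] [R1' R2']].
split; split=> k /=.
- by have [i h] := L1 k; have [j h'] := L1' i; exists j; apply: IHL h h'.
- by have [i h'] := L2' k; have [j h] := L2 i; exists j; apply: IHL h h'.
- by have [i h] := R1 k; have [j h'] := R1' i; exists j; apply: IHR h h'.
- by have [i h'] := R2' k; have [j h] := R2 i; exists j; apply: IHR h h'.
Qed.

#[local] Instance ident_Equivalence : Equivalence ident.
Proof. by split; [apply: ident_refl|apply: ident_sym|apply: ident_trans]. Qed.

Lemma ident_sign G H :
  ident G H -> (ge0 G <-> ge0 H) /\ (le0 G <-> le0 H).
Proof.
elim: G H => GLI GRI GL IHL GR IHR [HLI HRI HL HR] [[L1 L2] [R1 R2]].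
split; split=> nG /= -[k].
- by have [i /IHR[_ h]] := R2 k => /h ?; apply: nG; exists i.
- by have [i /IHR[_ h]] := R1 k => /h ?; apply: nG; exists i.
- by have [i /IHL[h _]] := L2 k => /h ?; apply: nG; exists i.
- by have [i /IHL[h _]] := L1 k => /h ?; apply: nG; exists i.
Qed.

Lemma eq0_ident G H : ident G H -> eq0 G -> eq0 H.
Proof. by move=> /ident_sign[gGH lGH] [/gGH ? /lGH ?]. Qed.

#[local] Instance addg_ident : Proper (ident ==> ident ==> ident)%signature addg.
Proof.
elim=> GLI GRI GL IHL GR IHR [G'LI G'RI G'L G'R] idG.
elim=> HLI HRI HL JHL HR JHR [H'LI H'RI H'L H'R] idH.
have [[L1 L2] [R1 R2]] := idG; have [[L1' L2'] [R1' R2']] := idH.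
split; split=> -[] k.
- by have [i h] := L1 k; exists (inl i); apply: IHL.
- by have [i h] := L1' k; exists (inr i); apply: JHL.
- by have [i h] := L2 k; exists (inl i); apply: IHL.
- by have [i h] := L2' k; exists (inr i); apply: JHL.
- by have [i h] := R1 k; exists (inl i); apply: IHR.
- by have [i h] := R1' k; exists (inr i); apply: JHR.
- by have [i h] := R2 k; exists (inl i); apply: IHR.
- by have [i h] := R2' k; exists (inr i); apply: JHR.
Qed.

(** * Rearranging sums and negatives *)

Lemma addgC G H : ident (addg G H) (addg H G).
Proof.
elim: G H => GLI GRI GL IHL GR IHR; elim=> HLI HRI HL JHL HR JHR.
pose swap (A B : Type) (k : A + B) : B + A :=
  match k with inl a => inr a | inr b => inl b end.
by split; apply: (@bitotal_maps _ _ _ (@swap _ _) (@swap _ _));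
  case=> k; rewrite /swap; auto.
Qed.

Lemma addgA G H K : ident (addg G (addg H K)) (addg (addg G H) K).
Proof.
elim: G H K => GLI GRI GL IHL GR IHR.
elim=> HLI HRI HL JHL HR JHR; elim=> KLI KRI KL KHL KR KHR.
pose assl (A B C : Type) (k : A + (B + C)) : (A + B) + C :=
  match k with
  | inl a => inl (inl a) | inr (inl b) => inl (inr b) | inr (inr c) => inr c
  end.
pose assr (A B C : Type) (k : (A + B) + C) : A + (B + C) :=
  match k with
  | inl (inl a) => inl a | inl (inr b) => inr (inl b) | inr c => inr (inr c)
  end.
split; apply: (@bitotal_maps _ _ _ (@assl _ _ _) (@assr _ _ _)).
- by case=> [k|[k|k]]; [apply: IHL|apply: JHL|apply: KHL].
- by case=> [[k|k]|k]; [apply: IHL|apply: JHL|apply: KHL].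
- by case=> [k|[k|k]]; [apply: IHR|apply: JHR|apply: KHR].
- by case=> [[k|k]|k]; [apply: IHR|apply: JHR|apply: KHR].
Qed.

Lemma addgACA A B C D :
  ident (addg (addg A B) (addg C D)) (addg (addg A C) (addg B D)).
Proof. by rewrite -addgA -(addgA A C) (addgA B) (addgA C) (addgC B C). Qed.

Definition zerog : game := Game (of_void game) (of_void game).

Lemma addg0 G : ident (addg G zerog) G.
Proof.
elim: G => LI RI GL IHL GR IHR.
pose drop0 (A : Type) (k : A + void) : A :=
  match k with inl a => a | inr e => of_void A e end.
by split; apply: (@bitotal_maps _ _ _ (@drop0 _) inl) => // -[].
Qed.

Lemma oppgK : involutive oppg.
Proof. by elim=> LI RI GL IHL GR IHR /=; congr Game; apply: funext. Qed.

Lemma oppgD G H : oppg (addg G H) = addg (oppg G) (oppg H).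
Proof.
elim: G H => GLI GRI GL IHL GR IHR; elim=> HLI HRI HL JHL HR JHR.
congr Game; apply: funext=> -[] k.
- exact: IHR.
- exact: JHR.
- exact: IHL.
- exact: JHL.
Qed.

Lemma oppg0 : oppg zerog = zerog.
Proof. by congr Game; apply: funext. Qed.

Lemma oppg_sign G : (ge0 (oppg G) <-> le0 G) /\ (le0 (oppg G) <-> ge0 G).
Proof.
elim: G => LI RI GL IHL GR IHR.
split; split=> nG /= -[k Gk]; apply: nG; exists k.
- exact/(IHL k).2.
- exact/(IHL k).2.
- exact/(IHR k).1.
- exact/(IHR k).1.
Qed.

Lemma eq0_opp G : eq0 G -> eq0 (oppg G).
Proof. by case=> ? ?; split; [apply/(oppg_sign G).1|apply/(oppg_sign G).2]. Qed.

(** * Signs of sums *)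

(** Left replies in the component where Right has moved. The last two conjuncts
    are the positions in the middle of such an exchange, with Left to move;
    carrying them along makes the induction structural. *)
Lemma sum_strategy G H :
  [/\ ge0 G -> ge0 H -> ge0 (addg G H),
      ~ le0 G -> ge0 H -> ~ le0 (addg G H)
    & ge0 G -> ~ le0 H -> ~ le0 (addg G H)].
Proof.
elim: G H => GLI GRI GL IHL GR IHR; elim=> HLI HRI HL JHL HR JHR.
split=> [gG gH [[k|k]] | lG gH | gG lH].
- have [_ h _] := IHR k (Game HL HR); apply: h => // lk.
  by apply: gG; exists k.
- have [_ _ h] := JHR k; apply: h => // lk.
  by apply: gH; exists k.
- move=> nS; apply: lG => -[i gi]; apply: nS; exists (inl i).
  by have [h _ _] := IHL i (Game HL HR); apply: h.
- move=> nS; apply: lH => -[i gi]; apply: nS; exists (inr i).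
  by have [h _ _] := JHL i; apply: h.
Qed.

Lemma ge0_add G H : ge0 G -> ge0 H -> ge0 (addg G H).
Proof. by have [] := sum_strategy G H. Qed.

Lemma le0_add G H : le0 G -> le0 H -> le0 (addg G H).
Proof.
move=> /(oppg_sign G).1 gG /(oppg_sign H).1 gH.
by apply/(oppg_sign _).1; rewrite oppgD; apply: ge0_add.
Qed.

Lemma eq0_add G H : eq0 G -> eq0 H -> eq0 (addg G H).
Proof. by move=> [? ?] [? ?]; split; [apply: ge0_add|apply: le0_add]. Qed.

(** A move of Right to some [GR j] with [le0 (GR j)] leads in the sum to
    [addg (GR j) H], which is again [le0]. *)
Lemma ge0_cancelr G H : le0 H -> ge0 (addg G H) -> ge0 G.
Proof.
case: G H => GLI GRI GL GR [HLI HRI HL HR] lH gS [j lj].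
by apply: gS; exists (inl j); apply: (le0_add lj lH).
Qed.

Lemma eq0_cancelr G H : eq0 H -> eq0 (addg G H) -> eq0 G.
Proof.
move=> zH zS; split; first exact: ge0_cancelr zH.2 zS.1.
apply/(oppg_sign G).1/(@ge0_cancelr _ (oppg H)); first exact: (eq0_opp zH).2.
by rewrite -oppgD; exact: (eq0_opp zS).1.
Qed.

Lemma left_option_addl K G H :
  is_left_option K G -> is_left_option (addg K H) (addg G H).
Proof.
by case: G H => ? ? ? ? [? ? ? ?] [i <-]; exists (inl i).
Qed.

Lemma left_option_addr K G H :
  is_left_option K H -> is_left_option (addg G K) (addg G H).
Proof.
by case: G H => ? ? ? ? [? ? ? ?] [i <-]; exists (inr i).
Qed.

Lemma le0_left_option K G : is_left_option K G -> ge0 K -> ~ le0 G.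
Proof. by case: G => ? ? ? ? [i <-] gK; apply; exists i. Qed.

(** Copying strategy: after a move in one of [G] and [oppg G], the mirror move
    in the other restores a position of the form [subg K K]. *)
Lemma ge0_subgg G : ge0 (subg G G).
Proof.
elim: G => LI RI GL IHL GR IHR [[k|k]].
- by apply: le0_left_option (IHR k); apply: left_option_addr; exists k.
- by apply: le0_left_option (IHL k); apply: (@left_option_addl _ (Game GL GR)); exists k.
Qed.

Lemma eq0_subgg G : eq0 (subg G G).
Proof.
split; first exact: ge0_subgg.
apply/(oppg_sign _).1; rewrite /subg oppgD oppgK.
exact/(ident_sign (addgC _ _)).1/ge0_subgg.
Qed.

(** * Equality of games is a congruence *)

Lemma ident_eqg G H : ident G H -> eqg G H.
Proof.
move=> idGH; apply: (@eq0_ident (subg H H)); last exact: eq0_subgg.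
by rewrite /subg idGH.
Qed.

Lemma eqg0 G : eqg G zerog <-> eq0 G.
Proof.
rewrite /eqg /subg oppg0; have idG := addg0 G.
by split; apply: eq0_ident => //; symmetry.
Qed.

Lemma eqg_sym : Symmetric eqg.
Proof.
move=> G H /eq0_opp; apply: eq0_ident.
by rewrite /subg oppgD oppgK addgC.
Qed.

Lemma eqg_trans : Transitive eqg.
Proof.
move=> G H K zGH zHK; apply: (@eq0_cancelr _ (subg H H)); first exact: eq0_subgg.
apply: eq0_ident (eq0_add zGH zHK).
by rewrite /subg (addgC H (oppg K)) addgACA (addgC (oppg H)).
Qed.

#[local] Instance eqg_Equivalence : Equivalence eqg.
Proof. by split; [apply: eq0_subgg|apply: eqg_sym|apply: eqg_trans]. Qed.

#[local] Instance addg_eqg : Proper (eqg ==> eqg ==> eqg)%signature addg.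
Proof.
move=> G G' zG H H' zH; apply: eq0_ident (eq0_add zG zH).
by rewrite /subg oppgD addgACA.
Qed.

#[local] Instance oppg_eqg : Proper (eqg ==> eqg)%signature oppg.
Proof. by move=> G G' /eq0_opp; rewrite /subg oppgD. Qed.

(** * The group of classes *)

Lemma class_ofP G H : class_of G = class_of H <-> eqg G H.
Proof.
split=> [/(congr1 sval) /= eqC | eqGH].
  have : [set K | eqg H K]%classic H by exact: eq0_subgg.
  by rewrite -eqC.
apply: eq_exist; apply/seteqP; split=> K /= eqK; last by rewrite eqGH.
by rewrite -eqGH.
Qed.

Lemma class_of_surj (C : game_class) : exists G, class_of G = C.
Proof. by case: C => C [G defC]; exists G; apply: eq_exist. Qed.

Definition repr (C : game_class) : game := sval (cid (class_of_surj C)).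

Lemma reprK : cancel repr class_of.
Proof. by move=> C; exact: svalP (cid (class_of_surj C)). Qed.

Lemma repr_class G : eqg (repr (class_of G)) G.
Proof. by apply/class_ofP; rewrite reprK. Qed.

Definition addc (C D : game_class) : game_class :=
  class_of (addg (repr C) (repr D)).

Definition oppc (C : game_class) : game_class := class_of (oppg (repr C)).

Lemma addc_class G H : addc (class_of G) (class_of H) = class_of (addg G H).
Proof. apply/class_ofP; rewrite !repr_class; reflexivity. Qed.

Lemma oppc_class G : oppc (class_of G) = class_of (oppg G).
Proof. apply/class_ofP; rewrite repr_class; reflexivity. Qed.

Lemma addcA : associative addc.
Proof.
move=> C D E; rewrite -(reprK C) -(reprK D) -(reprK E) !addc_class.
exact/class_ofP/ident_eqg/addgA.
Qed.

Lemma addcC : commutative addc.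
Proof. by move=> C D; exact/class_ofP/ident_eqg/addgC. Qed.

Lemma add0c : left_id (class_of zerog) addc.
Proof.
move=> C; rewrite addcC -(reprK C) addc_class.
exact/class_ofP/ident_eqg/addg0.
Qed.

Lemma addNc : left_inverse (class_of zerog) oppc addc.
Proof.
move=> C; rewrite addcC -(reprK C) oppc_class addc_class.
exact/class_ofP/eqg0/eq0_subgg.
Qed.

Definition game_class_isZmodule : GRing.isZmodule game_class :=
  GRing.isZmodule.Build game_class addcA addcC add0c addNc.

Theorem theorem2p16 :
  [/\ Equivalence eqg,
      Proper (eqg ==> eqg ==> eqg)%signature addg,
      Proper (eqg ==> eqg)%signature oppg
    & exists M : GRing.isZmodule game_class,
        let V := game_zmod M in
        let cl : game -> V := class_of in
        [/\ forall G H : game, cl (addg G H) = cl G + cl H,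
            forall G : game, cl (oppg G) = - cl G
          & forall G : game, eq0 G <-> cl G = 0]].
Proof.
split; [exact: eqg_Equivalence|exact: addg_eqg|exact: oppg_eqg|].
exists game_class_isZmodule; split.
- by move=> G H; symmetry; exact: addc_class.
- by move=> G; symmetry; exact: oppc_class.
- by move=> G; rewrite -eqg0; symmetry; exact: class_ofP.
Qed.
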